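(* Let $\mu_i>0$ for $i\in\{1,\dots,N\}$, $g(\mathbf W):=\frac12\|\mathbf W_1\mathbf W_2\cdots\mathbf W_N\mathbf X-\mathbf Y\|_F^2$, $f(\mathbf W):=\sum_{i=1}^N\mu_i\|\mathbf W_i\|_1$, and let $h$ be the kernel specified in the context. Consider the BPG iteration $\mathbf W^{\mathbf{k+1}}\in T_\lambda(\mathbf W^{\mathbf k})$, and denote $\mathbf P_i^k:=\lambda\nabla_{\mathbf W_i}g(\mathbf W^{\mathbf k})-\nabla_{\mathbf W_i}h(\mathbf W^{\mathbf k})$. Then the update steps in each iteration are given by $$\mathbf W_i^{k+1}=r\,\frac{\sqrt N\,\mathcal S_{\lambda\mu_i}(-\mathbf P_i^k)}{\sqrt{\sum_{j=1}^N\|\mathcal S_{\lambda\mu_j}(-\mathbf P_j^k)\|_F^2}}\qquad\text{for all } i\in\{1,\dots,N\},$$ where $r$ is the non-negative real root of (a) for $N=2$: $$2c_1(2)r^3+c_2(2)r-\frac{\sqrt{\sum_{i=1}^2\|\mathcal S_{\lambda\mu_i}(-\mathbf P_i^k)\|_F^2}}{\sqrt2}=0;$$ (b) for $N>2$ even: $$2c_1(N)r^{2N-1}+c_2(N)r^{N-1}+\frac{2\rho}N r-\frac{\sqrt{\sum_{i=1}^N\|\mathcal S_{\lambda\mu_i}(-\mathbf P_i^k)\|_F^2}}{\sqrt N}=0;$$ (c) for $N>2$ odd: $$2c_1(N)r^{2N-1}+c_3(N)\left(\frac{Nr^2+1}{N+1}\right)^{\frac{N-1}2}r+\frac{2\rho}N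 r-\frac{\sqrt{\sum_{i=1}^N\|\mathcal S_{\lambda\mu_i}(-\mathbf P_i^k)\|_F^2}}{\sqrt N}=0.$$
   Context: Setting: $N\ge2$ is an integer, $d_1,\dots,d_N,d,n_T$ are positive integers, $d_{N+1}:=d$, $\mathcal W_i:=\mathbb R^{d_i\times d_{i+1}}$, $\mathcal W:=\mathcal W_1\times\cdots\times\mathcal W_N$, with elements $\mathbf W=(\mathbf W_1,\dots,\mathbf W_N)$ and $\|\mathbf W\|_F^2:=\sum_{i=1}^N\|\mathbf W_i\|_F^2$. The matrices $\mathbf X\in\mathbb R^{d\times n_T}$, $\mathbf Y\in\mathbb R^{d_1\times n_T}$ are fixed. $\|\mathbf W_i\|_1$ is the sum of the absolute values of all entries of $\mathbf W_i$. The soft-thresholding operator is $\mathcal S_\theta(x)=\max\{|x|-\theta,0\}\,\mathrm{sgn}(x)$, applied entrywise. Constants and kernels: $c_1(N)=\frac{(2N-1)N^N}{2N!}\|\mathbf X\|_F^2$; for even $N$, $c_2(N)=\frac{\|\mathbf Y\|_F\|\mathbf X\|_F(N-1)N^{(N-2)/2}}{(N-2)^{(N-2)/2}}$ (with $0^0=1$ for $N=2$); for odd $N$, $c_3(N)=\frac{\|\mathbf Y\|_F\|\mathbf X\|_F(N-1)(N+1)^{(N-1)/2}}{(N-1)^{(N-1)/2}}$. $H_1(\mathbf W)=\left(\frac{\|\mathbf W\|_F^2}{N}\right)^N$, $H_2(\mathbf W)=\left(\frac{\|\mathbf W\|_F^2}{N}\right)^{N/2}$, $H_3(\mathbf W)=\left(\frac{\|\mathbf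 W\|_F^2+1}{N+1}\right)^{(N+1)/2}$, $H_4(\mathbf W)=\frac{\|\mathbf W\|_F^2}{N}$. The kernel $h$ is: for $N=2$, $h=c_1(2)H_1+c_2(2)H_2$; for even $N>2$, $h=c_1(N)H_1+c_2(N)H_2+\rho H_4$ with a fixed $\rho>0$; for odd $N>2$, $h=c_1(N)H_1+c_3(N)H_3+\rho H_4$ with a fixed $\rho\ge0$. It is a standing assumption that $h$ is $\sigma$-strongly convex for some $\sigma>0$. Bregman distance: $D_h(u,x)=h(u)-h(x)-\langle\nabla h(x),u-x\rangle$. BPG (Bregman Proximal Gradient) for minimizing $f+g$: fix a step size $0<\lambda<1/L$, where $L>0$ is such that $Lh-g$ and $Lh+g$ are convex on $\mathcal W$; choose an initial point, and for each $k\ge1$ compute $\mathbf W^{\mathbf{k+1}}\in T_\lambda(\mathbf W^{\mathbf k})$, where $$T_\lambda(x):=\operatorname*{argmin}_{u}\left\{f(u)+\langle\nabla g(x),u\rangle+\tfrac1\lambda D_h(u,x)\right\}.$$ Convention: if $\mathcal S_{\lambda\mu_j}(-\mathbf P_j^k)=0$ for all $j$, the update formula is read as $\mathbf W_i^{k+1}=0$ for all $i$. *)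

(* Defs.v *)
From HB Require Import structures.
From mathcomp Require Import all_boot all_order all_algebra.
From mathcomp Require Import all_classical all_reals all_analysis.

Set Implicit Arguments.
Unset Strict Implicit.
Unset Printing Implicit Defensive.

Import Order.TTheory GRing.Theory Num.Theory.

Local Open Scope ring_scope.

(* The space W_1 x ... x W_N.  Layers are numbered from 0 and the dimensions
   are d 0, ..., d N: layer i is a d i x d i.+1 matrix.  The values of d
   beyond N play no role. *)
Definition params (R : realType) (N : nat) (d : nat -> nat) : Type :=
  forall i : 'I_N, 'M[R]_(d i, d i.+1).

Section ParamsLmodule.
Variables (R : realType) (N : nat) (d : nat -> nat).
Local Notation T := (params R N d).
Implicit Types U V W : T.

HB.instance Definition _ := gen_eqMixin T.
HB.instance Definition _ := gen_choiceMixin T.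

Definition params_zero : T := fun=> 0.
Definition params_opp U : T := fun i => - U i.
Definition params_add U V : T := fun i => U i + V i.
Definition params_scale (a : R) U : T := fun i => a *: U i.

Fact params_addA : associative params_add.
Proof. by move=> U V W; apply: functional_extensionality_dep => i; exact: addrA. Qed.

Fact params_addC : commutative params_add.
Proof. by move=> U V; apply: functional_extensionality_dep => i; exact: addrC. Qed.

Fact params_add0 : left_id params_zero params_add.
Proof. by move=> U; apply: functional_extensionality_dep => i; exact: add0r. Qed.

Fact params_addN : left_inverse params_zero params_opp params_add.
Proof. by move=> U; apply: functional_extensionality_dep => i; exact: addNr. Qed.

HB.instance Definition _ :=
  GRing.isZmodule.Build T params_addA params_addC params_add0 params_addN.

Fact params_scaleA (a b : R) U :
  params_scale a (params_scale b U) = params_scale (a * b) U.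
Proof. by apply: functional_extensionality_dep => i; exact: scalerA. Qed.

Fact params_scale1 : left_id 1 params_scale.
Proof. by move=> U; apply: functional_extensionality_dep => i; exact: scale1r. Qed.

Fact params_scaleDr : right_distributive params_scale +%R.
Proof. by move=> a U V; apply: functional_extensionality_dep => i; exact: scalerDr. Qed.

Fact params_scaleDl U : {morph params_scale^~ U : a b / a + b}.
Proof. by move=> a b; apply: functional_extensionality_dep => i; exact: scalerDl. Qed.

HB.instance Definition _ := GRing.Zmodule_isLmodule.Build R T
  params_scaleA params_scale1 params_scaleDr params_scaleDl.

End ParamsLmodule.

Section Matrices.
Variables (R : realType) (m n : nat).
Implicit Types A : 'M[R]_(m, n).

Definition frob A : R := Num.sqrt (\sum_i \sum_j A i j ^+ 2).

(* Sum of the absolute values of the entries, not an operator norm. *)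
Definition norm1 A : R := \sum_i \sum_j `|A i j|.

Definition soft (theta : R) A : 'M[R]_(m, n) :=
  map_mx (fun x => Num.max (`|x| - theta) 0 * Num.sg x) A.

End Matrices.

Section Calculus.
Variables (R : realType) (N : nat) (d : nat -> nat).
Local Notation T := (params R N d).

Definition sqnormF (W : T) : R := \sum_i frob (W i) ^+ 2.

Definition inner (U V : T) : R := \sum_i \sum_a \sum_b U i a b * V i a b.

(* Canonical basis vector: entry (a, b) of layer i is 1, all others are 0.
   Row and column indices are compared as natural numbers because those of
   layers i and j live in different types. *)
Definition basis_params (i : 'I_N) (a : 'I_(d i)) (b : 'I_(d i.+1)) : T :=
  fun j => \matrix_(p, q) [&& j == i, p == a :> nat & q == b :> nat]%:R.

(* [grad F W i] is the partial gradient of F with respect to layer i at W. *)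
Definition grad (F : T -> R) (W : T) : T :=
  fun i => \matrix_(a, b)
    (fun t : R => F (W + t *: basis_params a b))^`()%classic 0.

Definition convex (F : T -> R) : Prop :=
  @convex_function R T setT F.

Definition strongly_convex (sigma : R) (F : T -> R) : Prop :=
  forall (U V : T) (t : R), 0 <= t <= 1 ->
    F (t *: U + (1 - t) *: V) <=
      t * F U + (1 - t) * F V - sigma / 2 * t * (1 - t) * sqnormF (U - V).

Definition bregman (h : T -> R) (U V : T) : R :=
  h U - h V - inner (grad h V) (U - V).

Definition bpg_map (f g h : T -> R) (lambda : R) (V : T) : set T :=
  let obj U := f U + inner (grad g V) U + lambda^-1 * bregman h U V in
  [set U | forall U', obj U <= obj U'].

End Calculus.

(* The ordered product W_1 W_2 ... W_N. *)
Fixpoint layer_prod (R : realType) (d : nat -> nat) (N : nat) :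
    params R N d -> 'M[R]_(d 0%N, d N) :=
  match N return params R N d -> 'M[R]_(d 0%N, d N) with
  | 0%N => fun=> 1%:M
  | n.+1 => fun W =>
      @layer_prod R d n (fun i => W (widen_ord (leqnSn n) i)) *m W ord_max
  end.

Section Network.
Variables (R : realType) (N nT : nat) (d : nat -> nat).
Variables (X : 'M[R]_(d N, nT)) (Y : 'M[R]_(d 0%N, nT)).
Local Notation T := (params R N d).
Implicit Types W : T.

Definition loss W : R := 2^-1 * frob (layer_prod W *m X - Y) ^+ 2.

Definition l1_reg (mu : 'I_N -> R) W : R := \sum_i mu i * norm1 (W i).

(* powR satisfies 0 `^ 0 = 1, as needed in c2 for N = 2. *)
Definition c1 : R :=
  (2 * N%:R - 1) * N%:R ^+ N / (2 * (N`!)%:R) * frob X ^+ 2.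

Definition c2 : R :=
  frob Y * frob X * (N%:R - 1) * N%:R `^ ((N%:R - 2) / 2) /
    (N%:R - 2) `^ ((N%:R - 2) / 2).

Definition c3 : R :=
  frob Y * frob X * (N%:R - 1) * (N%:R + 1) `^ ((N%:R - 1) / 2) /
    (N%:R - 1) `^ ((N%:R - 1) / 2).

Definition H1 W : R := (sqnormF W / N%:R) ^+ N.
Definition H2 W : R := (sqnormF W / N%:R) `^ (N%:R / 2).
Definition H3 W : R := ((sqnormF W + 1) / (N%:R + 1)) `^ ((N%:R + 1) / 2).
Definition H4 W : R := sqnormF W / N%:R.

Definition dlnn_kernel (rho : R) W : R :=
  if N == 2%N then c1 * H1 W + c2 * H2 W
  else if ~~ odd N then c1 * H1 W + c2 * H2 W + rho * H4 W
  else c1 * H1 W + c3 * H3 W + rho * H4 W.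

Definition root_eq (rho s r : R) : Prop :=
  if N == 2%N then
    2 * c1 * r ^+ 3 + c2 * r - s / Num.sqrt 2 = 0
  else if ~~ odd N then
    2 * c1 * r ^+ (2 * N - 1) + c2 * r ^+ (N - 1) + 2 * rho / N%:R * r
      - s / Num.sqrt N%:R = 0
  else
    2 * c1 * r ^+ (2 * N - 1)
      + c3 * ((N%:R * r ^+ 2 + 1) / (N%:R + 1)) `^ ((N%:R - 1) / 2) * r
      + 2 * rho / N%:R * r - s / Num.sqrt N%:R = 0.

End Network.

(* Main.v *)
Require Import Defs.
From HB Require Import structures.
From mathcomp Require Import all_boot all_order all_algebra.
From mathcomp Require Import all_classical all_reals all_analysis.
From mathcomp Require Import ring lra.

Set Implicit Arguments.
Unset Strict Implicit.
Unset Printing Implicit Defensive.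

Import Order.TTheory GRing.Theory Num.Theory.

Local Open Scope ring_scope.

(** The kernel depends on W only through the radius t = ||W||_F / sqrt N, say
    h W = Phi t.  Multiplied by lambda and stripped of constants, the function
    minimized at each step is therefore
      F U = sum_i theta_i ||U_i||_1 + <P, U> + Phi (radius U),
    with theta_i = lambda mu_i.  Only this shape matters: P may be any vector,
    so neither gradient has to be computed.

    Let S be the soft-thresholding of - P and s its norm.  Entry by entry,
    theta |u| + p u >= - S u, with equality when u is a nonnegative multiple of
    S ([l1_inner_lower], [l1_inner_tight]).  By Cauchy-Schwarz,
      F U >= - <S, U> + Phi t >= - s sqrt N t + Phi t,
    and both inequalities are equalities on the ray spanned by S.  What is left
    is a one-variable problem whose stationarity equation
    Phi' r = sqrt N s is N times the root equation.  Since Phi lies strictly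
    above its tangents ([profile_above_tangent]), its root r is the only
    minimizing radius, and the equality case of Cauchy-Schwarz gives the
    direction ([prox_radial]).

    The root exists by the intermediate value theorem for polynomials
    ([profile_slope_onto]) and is unique because a strict tangent inequality
    makes the slope injective ([profile_slope_inj]).  Both need the coefficient
    of H1 or that of H4 to be positive.  If both vanish then X = 0, all the
    coefficients vanish and h = 0, which strong convexity excludes
    ([kernel_nondegenerate]). *)

(** * One-variable profile of the kernel *)

Section Profile.
Variable R : realType.
Implicit Types (t r a b c e : R) (n m : nat).

(** Bernoulli's inequality in homogeneous form: passing from n to n + 1
    multiplies the gap by t and adds n r^(n-1) (t - r)^2, so no derivative is
    needed. *)
Lemma pow_above_tangent n t r : 0 <= t -> 0 <= r ->
  n%:R * r ^+ n.-1 * (t - r) <= t ^+ n - r ^+ n.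
Proof.
move=> t0 r0; elim: n => [|n IH]; first by rewrite !mul0r !expr0 subrr.
rewrite -subr_ge0 /=.
have -> : t ^+ n.+1 - r ^+ n.+1 - n.+1%:R * r ^+ n * (t - r) =
    t * (t ^+ n - r ^+ n - n%:R * r ^+ n.-1 * (t - r))
    + n%:R * r ^+ n.-1 * (t - r) ^+ 2.
  by case: n {IH} => [|n]; rewrite ?expr0 ?expr1 /= ?exprS -?natr1; ring.
apply: addr_ge0; first by rewrite mulr_ge0 ?subr_ge0.
by rewrite mulr_ge0 ?sqr_ge0 // mulr_ge0 ?exprn_ge0 ?ler0n.
Qed.

(** The square added by the last induction step is positive unless r = 0,
    and then the claim is 0 < t^n. *)
Lemma pow_above_tangent_strict n t r : (1 < n)%N -> 0 <= t -> 0 <= r ->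
  t != r -> n%:R * r ^+ n.-1 * (t - r) < t ^+ n - r ^+ n.
Proof.
case: n => [|[|n]] // _ t0 r0 tr /=.
have [r_eq0|rn0] := eqVneq r 0.
  rewrite r_eq0 !exprS !mul0r mulr0 mul0r !subr0 -!exprS exprn_gt0 //.
  by rewrite lt_def t0 -r_eq0 tr.
have r_gt0 : 0 < r by rewrite lt_def rn0.
rewrite -subr_gt0.
have -> : t ^+ n.+2 - r ^+ n.+2 - n.+2%:R * r ^+ n.+1 * (t - r) =
    t * (t ^+ n.+1 - r ^+ n.+1 - n.+1%:R * r ^+ n * (t - r))
    + n.+1%:R * r ^+ n * (t - r) ^+ 2.
  by rewrite !exprS -!natr1; ring.
rewrite ltr_wpDl //; last first.
  rewrite mulr_gt0 ?exprn_even_gt0 /= ?subr_eq0 //.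
  by rewrite mulr_gt0 ?exprn_gt0 ?ltr0n.
by rewrite mulr_ge0 // subr_ge0 (pow_above_tangent n.+1).
Qed.

Definition quad n t : R := (n%:R * t ^+ 2 + 1) / (n%:R + 1).

Lemma quad_ge0 n t : 0 <= quad n t.
Proof.
by rewrite divr_ge0 ?natr1 ?ler0n // addr_ge0 // mulr_ge0 ?ler0n ?sqr_ge0.
Qed.

(** All three kernels are instances: a, b, c, e are the coefficients of H1, H2,
    H3 and H4, and m is the exponent of H3. *)
Definition profile n m a b c e t : R :=
  a * t ^+ (2 * n) + b * t ^+ n + c * quad n t ^+ m + e * t ^+ 2.

(** The derivative of [profile] divided by n, which is the normalization of the
    root equations. *)
Definition profile_slope n m a b c e r : R :=
  2 * a * r ^+ (2 * n - 1) + b * r ^+ (n - 1)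
  + c * (2 * m%:R / (n%:R + 1)) * quad n r ^+ m.-1 * r + 2 * e / n%:R * r.

(** Composition of two convex functions: the gap left after applying the
    inequality for the m-th power to the values of [quad] is a
    nonnegative multiple of (t - r)^2. *)
Lemma quad_above_tangent n m t r : 0 <= t -> 0 <= r ->
  n%:R * (2 * m%:R / (n%:R + 1)) * quad n r ^+ m.-1 * r * (t - r)
    <= quad n t ^+ m - quad n r ^+ m.
Proof.
move=> t0 r0.
apply: le_trans (pow_above_tangent m (quad_ge0 n t) (quad_ge0 n r)).
have n1 : n%:R + 1 != 0 :> R by rewrite natr1 pnatr_eq0.
have -> : quad n t - quad n r =
    n%:R / (n%:R + 1) * (2 * r * (t - r) + (t - r) ^+ 2).
  by rewrite /quad; field.
rewrite -subr_ge0.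
set x := quad n r ^+ m.-1; have x0 : 0 <= x by rewrite exprn_ge0 ?quad_ge0.
have -> : m%:R * x * (n%:R / (n%:R + 1) * (2 * r * (t - r) + (t - r) ^+ 2))
   - n%:R * (2 * m%:R / (n%:R + 1)) * x * r * (t - r)
   = m%:R * x * (n%:R / (n%:R + 1)) * (t - r) ^+ 2 by field.
rewrite mulr_ge0 ?sqr_ge0 // !mulr_ge0 ?ler0n ?invr_ge0 ?addr_ge0 //.
Qed.

(** Strictness comes from the terms t^(2n) and t^2 alone; the other two may
    have zero coefficients. *)
Lemma profile_above_tangent n m a b c e t r : (0 < n)%N ->
    0 <= a -> 0 <= b -> 0 <= c -> 0 <= e -> 0 < a + e ->
    0 <= t -> 0 <= r -> t != r ->
  n%:R * profile_slope n m a b c e r * (t - r)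
    < profile n m a b c e t - profile n m a b c e r.
Proof.
move=> n0 a0 b0 c0 e0 ae t0 r0 tr.
have nN0 : n%:R != 0 :> R by rewrite pnatr_eq0 -lt0n.
have Ha := pow_above_tangent_strict (n := 2 * n) _ t0 r0 tr.
have {}Ha := Ha (leq_pmulr 2 n0).
have He := pow_above_tangent_strict (isT : 1 < 2)%N t0 r0 tr.
have {}Hb := ler_wpM2l b0 (pow_above_tangent n t0 r0).
have {}Hc := ler_wpM2l c0 (quad_above_tangent n m t0 r0).
have {Ha He} Hae : a * ((2 * n)%:R * r ^+ (2 * n).-1 * (t - r))
    + e * (2 * r ^+ 1 * (t - r))
    < a * (t ^+ (2 * n) - r ^+ (2 * n)) + e * (t ^+ 2 - r ^+ 2).
  have [a_gt0|a_le0] := ltrP 0 a.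
    by rewrite ltr_leD ?ltr_pM2l // ler_wpM2l // ltW.
  by rewrite ler_ltD ?ler_wpM2l ?ltr_pM2l //; [exact: ltW | lra].
have -> : n%:R * profile_slope n m a b c e r * (t - r) =
  (a * ((2 * n)%:R * r ^+ (2 * n).-1 * (t - r)) + e * (2 * r ^+ 1 * (t - r)))
  + b * (n%:R * r ^+ n.-1 * (t - r))
  + c * (n%:R * (2 * m%:R / (n%:R + 1)) * quad n r ^+ m.-1 * r * (t - r)).
  rewrite /profile_slope !subn1 natrM expr1; field.
  by rewrite nN0 natr1 pnatr_eq0.
have -> : profile n m a b c e t - profile n m a b c e r =
  (a * (t ^+ (2 * n) - r ^+ (2 * n)) + e * (t ^+ 2 - r ^+ 2))
  + b * (t ^+ n - r ^+ n) + c * (quad n t ^+ m - quad n r ^+ m).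
  by rewrite /profile; ring.
by rewrite ltr_leD // ltr_leD.
Qed.

(** The sum of the strict tangent inequalities from t to r and from r to t
    is contradictory when the slopes agree. *)
Lemma profile_slope_inj n m a b c e t r : (0 < n)%N ->
    0 <= a -> 0 <= b -> 0 <= c -> 0 <= e -> 0 < a + e ->
    0 <= t -> 0 <= r ->
  profile_slope n m a b c e t = profile_slope n m a b c e r -> t = r.
Proof.
move=> n0 a0 b0 c0 e0 ae t0 r0 eq_tr; apply/eqP; apply/negPn/negP => tr.
have := profile_above_tangent m n0 a0 b0 c0 e0 ae t0 r0 tr.
rewrite eq_sym in tr.
have := profile_above_tangent m n0 a0 b0 c0 e0 ae r0 t0 tr.
rewrite eq_tr; lra.
Qed.

Lemma profile_slope0 n m a b c e : (1 < n)%N -> profile_slope n m a b c e 0 = 0.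
Proof.
case: n => [|[|n]] // _.
by rewrite /profile_slope mulnS subn1 subn1 /= !expr0n /= !mulr0 !addr0.
Qed.

(** The slope is a polynomial function, equal to 0 at 0; it is at least
    (2 a + 2 e / n) r for r >= 1, hence unbounded. *)
Lemma profile_slope_onto n m a b c e (y : R) : (1 < n)%N ->
    0 <= a -> 0 <= b -> 0 <= c -> 0 <= e -> 0 < a + e -> 0 <= y ->
  exists2 r, 0 <= r & profile_slope n m a b c e r = y.
Proof.
move=> n1 a0 b0 c0 e0 ae y0.
have n0 : 0 < n%:R :> R by rewrite ltr0n ltnW.
pose q : {poly R} := ((n%:R * (n%:R + 1)^-1) *: 'X^2 + (n%:R + 1)^-1%:P).
pose p : {poly R} := (2 * a) *: 'X^(2 * n - 1) + b *: 'X^(n - 1)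
  + (c * (2 * m%:R / (n%:R + 1))) *: (q ^+ m.-1 * 'X)
  + (2 * e / n%:R) *: 'X - y%:P.
have qE x : q.[x] = quad n x.
  by rewrite /q /quad hornerD hornerZ hornerXn hornerC; ring.
have pE x : p.[x] = profile_slope n m a b c e x - y.
  rewrite /p /profile_slope -qE; clear qE; clearbody q.
  rewrite !(hornerD, hornerN, hornerZ, hornerXn, hornerC).
  by rewrite hornerX hornerM hornerX horner_exp mulrA.
pose k := 2 * a + 2 * e / n%:R.
have k0 : 0 < k.
  have [a_gt0|a_le0] := ltrP 0 a.
    by rewrite ltr_wpDr ?mulr_gt0 // !mulr_ge0 // invr_ge0 ltW.
  by rewrite ltr_wpDl ?mulr_ge0 // !mulr_gt0 ?invr_gt0 //; lra.
(* At M >= 1 the bound k M on the slope already exceeds y. *)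
pose M := 1 + y / k.
have M1 : 1 <= M by rewrite lerDl divr_ge0 // ltW.
have M0 : 0 <= M by lra.
have pM : p.[0] <= 0 <= p.[M].
  rewrite !pE profile_slope0 // sub0r oppr_le0 y0 subr_ge0.
  have : k * M <= profile_slope n m a b c e M.
    have HM : M <= M ^+ (2 * n - 1).
      rewrite ler_eXnr // subn_gt0.
      exact: (leq_trans _ (leq_pmulr 2 (ltnW n1))).
    have H1 := ler_wpM2l a0 HM.
    have H2 : 0 <= b * M ^+ (n - 1) by rewrite mulr_ge0 ?exprn_ge0.
    have H3 : 0 <= c * (2 * m%:R / (n%:R + 1)) * quad n M ^+ m.-1 * M.
      rewrite !mulr_ge0 ?exprn_ge0 ?quad_ge0 ?ler0n ?invr_ge0 ?natr1 ?ler0n //.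
    rewrite /profile_slope /k mulrDl; lra.
  apply: le_trans; rewrite /M mulrDr mulr1 mulrCA divff ?gt_eqF //; lra.
have [x /andP[x0 _]] := poly_ivt M0 pM.
rewrite rootE pE subr_eq0 => /eqP ?.
by exists x.
Qed.

End Profile.

(** * Soft-thresholding of a real number *)

Section SoftThreshold.
Variable R : realType.
Implicit Types z u theta : R.

Definition soft1 theta z : R := Num.max (`|z| - theta) 0 * Num.sg z.

Lemma soft1_dist_le theta z : 0 <= theta -> `|z - soft1 theta z| <= theta.
Proof.
move=> theta0; rewrite /soft1.
have [le_z|lt_z] := leP (`|z| - theta) 0.
  by rewrite mul0r subr0 -subr_le0.
have zn0 : z != 0 by apply/eqP => z0; move: lt_z; rewrite z0 normr0; lra.
rewrite {1}(numEsg z) [Num.sg z * _]mulrC -mulrBl normrM normr_sg zn0 mulr1.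
by rewrite opprB addrC subrK ger0_norm.
Qed.

(** The residual z - S is theta times the sign of S wherever S <> 0; with
    [soft1_dist_le] it says that the residual is a subgradient of theta |.|
    at S. *)
Lemma soft1_residual theta z :
  (z - soft1 theta z) * soft1 theta z = theta * `|soft1 theta z|.
Proof.
rewrite /soft1; have [le_z|lt_z] := leP (`|z| - theta) 0.
  by rewrite !mul0r normr0 !mulr0.
have [->|zn0] := eqVneq z 0; first by rewrite sgr0 !mulr0 normr0 mulr0.
rewrite {1}(numEsg z) [Num.sg z * _]mulrC -mulrBl.
rewrite normrM normr_sg zn0 mulr1 (gtr0_norm lt_z) mulrACA -expr2 sqr_sg zn0.
by rewrite mulr1 opprB addrC subrK.
Qed.

Lemma soft1_lower theta z u : 0 <= theta ->
  - (soft1 theta z * u) <= theta * `|u| - z * u.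
Proof.
move=> theta0; rewrite -subr_ge0.
have : (z - soft1 theta z) * u <= theta * `|u|.
  apply: le_trans (ler_norm _) _; rewrite normrM.
  by rewrite ler_wpM2r // soft1_dist_le.
lra.
Qed.

(** [soft1_lower] is an equality on the whole ray through the
    threshold value, not only at that value: this is why the minimizer is a
    rescaling of S. *)
Lemma soft1_tight theta z k : 0 <= k ->
  theta * `|k * soft1 theta z| - z * (k * soft1 theta z)
    = - (soft1 theta z * (k * soft1 theta z)).
Proof.
move=> k0; rewrite normrM ger0_norm // mulrCA -soft1_residual; ring.
Qed.

End SoftThreshold.

(** * Euclidean structure of the parameter space *)

Section InnerProduct.
Variables (R : realType) (N : nat) (d : nat -> nat).
Local Notation T := (params R N d).
Implicit Types U V Z P : T.

Lemma innerC U V : inner U V = inner V U.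
Proof.
apply: eq_bigr => i _; apply: eq_bigr => a _; apply: eq_bigr => b _.
by rewrite mulrC.
Qed.

Lemma innerDl U V Z : inner (U + V) Z = inner U Z + inner V Z.
Proof.
rewrite -big_split /=; apply: eq_bigr => i _.
rewrite -big_split /=; apply: eq_bigr => a _.
rewrite -big_split /=; apply: eq_bigr => b _.
by rewrite mxE mulrDl.
Qed.

Lemma innerZl k U V : inner (k *: U) V = k * inner U V.
Proof.
rewrite mulr_sumr; apply: eq_bigr => i _.
rewrite mulr_sumr; apply: eq_bigr => a _.
rewrite mulr_sumr; apply: eq_bigr => b _.
by rewrite mxE mulrA.
Qed.

Lemma innerNl U V : inner (- U) V = - inner U V.
Proof. by rewrite -scaleN1r innerZl mulN1r. Qed.

Lemma innerBl U V Z : inner (U - V) Z = inner U Z - inner V Z.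
Proof. by rewrite innerDl innerNl. Qed.

Lemma innerBr U V Z : inner U (V - Z) = inner U V - inner U Z.
Proof. by rewrite innerC innerBl !(innerC U). Qed.

Lemma innerZr k U V : inner U (k *: V) = k * inner U V.
Proof. by rewrite innerC innerZl innerC. Qed.

Lemma frob_sqr (m n : nat) (A : 'M[R]_(m, n)) :
  frob A ^+ 2 = \sum_i \sum_j A i j ^+ 2.
Proof.
rewrite sqr_sqrtr // sumr_ge0 // => i _.
by rewrite sumr_ge0 // => j _; exact: sqr_ge0.
Qed.

Lemma sqnormFE U : sqnormF U = inner U U.
Proof. by apply: eq_bigr => i _; rewrite frob_sqr. Qed.

Lemma sqnormF_ge0 U : 0 <= sqnormF U.
Proof. by apply: sumr_ge0 => i _; exact: sqr_ge0. Qed.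

Lemma sqnormFZ k U : sqnormF (k *: U) = k ^+ 2 * sqnormF U.
Proof. by rewrite !sqnormFE innerZl innerZr; ring. Qed.

Lemma sqnormF_eq0 U : sqnormF U = 0 -> U = 0.
Proof.
move=> U0; apply: functional_extensionality_dep => i; apply/matrixP => a b.
have /psumr_eq0P U0i : \sum_j frob (U j) ^+ 2 = 0 by [].
have {U0i} := U0i (fun j _ => sqr_ge0 _) i isT.
rewrite frob_sqr => /psumr_eq0P H.
have {H} := H (fun a _ => sumr_ge0 _ (fun b _ => sqr_ge0 _)) a isT.
move=> /psumr_eq0P H; have {H} := H (fun b _ => sqr_ge0 _) b isT.
by move=> /eqP; rewrite sqrf_eq0 => /eqP ->; rewrite mxE.
Qed.

(** Everything follows from
    || s U - t V ||^2 = 2 s t (s t - <V, U>), where s = ||V|| and t = ||U||: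
    the hypothesis makes the right-hand side nonpositive.  The collinearity is
    stated without division so that zero vectors need no exception. *)
Lemma cauchy_schwarz_eq (V U : T) :
  let s := Num.sqrt (sqnormF V) in let t := Num.sqrt (sqnormF U) in
  s * t <= inner V U -> inner V U = s * t /\ s *: U = t *: V.
Proof.
move=> s t le_st.
have s0 : 0 <= s by exact: sqrtr_ge0.
have t0 : 0 <= t by exact: sqrtr_ge0.
have s2 : inner V V = s ^+ 2 by rewrite -sqnormFE sqr_sqrtr ?sqnormF_ge0.
have t2 : inner U U = t ^+ 2 by rewrite -sqnormFE sqr_sqrtr ?sqnormF_ge0.
have E : sqnormF (s *: U - t *: V) = 2 * (s * t) * (s * t - inner V U).
  rewrite sqnormFE innerBl !innerBr !innerZl !innerZr (innerC U V) s2 t2; ring.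
have E0 : sqnormF (s *: U - t *: V) = 0.
  apply/eqP; rewrite eq_le sqnormF_ge0 andbT E.
  by rewrite mulr_ge0_le0 ?subr_le0 // mulr_ge0 ?mulr_ge0.
have sUtV := sqnormF_eq0 E0.
split; last by apply/eqP; rewrite -subr_eq0; apply/eqP.
move: E0; rewrite E => /eqP; rewrite mulf_eq0 subr_eq0 => /orP[|/eqP //].
rewrite mulf_eq0 pnatr_eq0 /= mulf_eq0 => /orP[] /eqP z0.
  have V0 : V = 0 by apply: sqnormF_eq0; rewrite sqnormFE s2 z0 expr0n.
  by rewrite z0 mul0r V0 -[0](scale0r V) innerZl mul0r.
have U0 : U = 0 by apply: sqnormF_eq0; rewrite sqnormFE t2 z0 expr0n.
by rewrite z0 mulr0 U0 -[0](scale0r V) innerZr mul0r.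
Qed.

(** Normalized by sqrt N because the root equations are written in this
    variable. *)
Definition radius U : R := Num.sqrt (sqnormF U / N%:R).

Lemma radius_ge0 U : 0 <= radius U. Proof. exact: sqrtr_ge0. Qed.

Lemma radius_sqr U : radius U ^+ 2 = sqnormF U / N%:R.
Proof. by rewrite sqr_sqrtr // divr_ge0 ?ler0n ?sqnormF_ge0. Qed.

Lemma sqrt_sqnormF U : (0 < N)%N ->
  Num.sqrt (sqnormF U) = Num.sqrt N%:R * radius U.
Proof.
by move=> N0; rewrite -sqrtrM ?ler0n // mulrC divfK // pnatr_eq0 -lt0n.
Qed.

(** * Proximal step for a radial kernel *)

Definition soft_oppr (theta : 'I_N -> R) P : T :=
  fun i => soft (theta i) (- P i).

Lemma l1_inner_lower theta P U : (forall i, 0 <= theta i) ->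
  - inner (soft_oppr theta P) U <= l1_reg theta U + inner P U.
Proof.
move=> theta0; rewrite /l1_reg /inner -sumrN -big_split /=.
apply: ler_sum => i _; rewrite /norm1 mulr_sumr -sumrN -big_split /=.
apply: ler_sum => a _; rewrite mulr_sumr -sumrN -big_split /=.
apply: ler_sum => b _; have := soft1_lower ((- P i) a b) (U i a b) (theta0 i).
by rewrite /soft_oppr /soft !mxE mulNr opprK.
Qed.

Lemma l1_inner_tight theta P k : 0 <= k ->
  let S := soft_oppr theta P in
  l1_reg theta (k *: S) + inner P (k *: S) = - (k * sqnormF S).
Proof.
move=> k0 S; rewrite sqnormFE -innerZr /l1_reg /inner -sumrN -big_split /=.
apply: eq_bigr => i _; rewrite /norm1 mulr_sumr -sumrN -big_split /=.
apply: eq_bigr => a _; rewrite mulr_sumr -sumrN -big_split /=.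
apply: eq_bigr => b _; have := soft1_tight (theta i) ((- P i) a b) k0.
by rewrite /S /soft_oppr /soft !mxE mulNr opprK.
Qed.

(** A minimizer U competes with the claimed vector k S, whose objective value
    is - s sqrt N r + Phi r.  If the radius t of U differed from r, the strict
    tangent inequality at r would force <S, U> > s ||U||, against
    Cauchy-Schwarz.  So t = r, Cauchy-Schwarz is an equality, and U is
    collinear with S.  The hypothesis s = 0 -> r = 0 settles the degenerate
    case S = 0, where both sides are 0. *)
Lemma prox_radial (theta : 'I_N -> R) (Phi : R -> R) P U r :
    (0 < N)%N -> (forall i, 0 <= theta i) ->
    let S := soft_oppr theta P in let s := Num.sqrt (sqnormF S) in
    0 <= r -> (s = 0 -> r = 0) ->
    (forall t, 0 <= t -> t != r ->
      s * Num.sqrt N%:R * (t - r) < Phi t - Phi r) ->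
    (forall U', l1_reg theta U + inner P U + Phi (radius U) <=
                l1_reg theta U' + inner P U' + Phi (radius U')) ->
  U = (r * (Num.sqrt N%:R / s)) *: S.
Proof.
move=> N0 theta0 S s r0 s0r0 slope minU.
set n := Num.sqrt N%:R in slope *.
have n0 : 0 < n by rewrite sqrtr_gt0 ltr0n.
have s0 : 0 <= s by exact: sqrtr_ge0.
have s2 : sqnormF S = s ^+ 2 by rewrite sqr_sqrtr ?sqnormF_ge0.
set k := r * (n / s).
have k0 : 0 <= k by rewrite !mulr_ge0 ?invr_ge0 // ltW.
(* When s = 0 the quotient in k is 0, and r = 0 saves the identity. *)
have ks : k * s = r * n.
  rewrite /k; have [z|sn0] := eqVneq s 0; first by rewrite s0r0 // !mul0r.
  by rewrite -mulrA divfK.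
have Rk : radius (k *: S) = r.
  rewrite /radius sqnormFZ s2 -exprMn ks exprMn sqr_sqrtr ?ler0n //.
  by rewrite mulfK ?sqrtr_sqr ?ger0_norm // pnatr_eq0 -lt0n.
have := minU (k *: S); rewrite l1_inner_tight // Rk s2 expr2 mulrA ks.
have := l1_inner_lower P U theta0; rewrite -/S => low minU'.
have nU := sqrt_sqnormF U N0; rewrite -/n in nU.
have Ur : radius U = r.
  apply/eqP/negPn/negP => Un; have slopeU := slope _ (radius_ge0 U) Un.
  have lt_in : s * Num.sqrt (sqnormF U) < inner S U.
    rewrite nU; move: low minU' slopeU; set x := radius U; lra.
  have [eq_in _] := cauchy_schwarz_eq (ltW lt_in).
  by move: lt_in; rewrite eq_in ltxx.
have le_in : s * Num.sqrt (sqnormF U) <= inner S U.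
  by rewrite nU; move: low minU'; rewrite Ur; lra.
have [_ dirU] := cauchy_schwarz_eq le_in; rewrite -/s nU Ur in dirU.
have [z|sn0] := eqVneq s 0.
  rewrite /k z invr0 !mulr0 scale0r; apply: sqnormF_eq0.
  by rewrite -[LHS](@sqr_sqrtr _ _ (sqnormF_ge0 U)) nU Ur s0r0 // mulr0 expr0n.
rewrite /k mulrA [r * n]mulrC [_ / s]mulrC -scalerA -dirU.
by rewrite scalerA mulVf ?scale1r.
Qed.

End InnerProduct.

(** * The network kernel as a profile of the radius *)

Section Kernel.
Variables (R : realType) (N nT : nat) (d : nat -> nat).
Variables (X : 'M[R]_(d N, nT)) (Y : 'M[R]_(d 0%N, nT)) (rho : R).
Hypothesis N_ge2 : (2 <= N)%N.

Definition coefH2 : R := if odd N then 0 else c2 X Y.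
Definition coefH3 : R := if odd N then c3 X Y else 0.
Definition coefH4 : R := if N == 2%N then 0 else rho.

(** The real exponents N / 2 and (N + 1) / 2 are natural numbers in the parity
    in which they occur; for odd N, the latter is N./2 + 1. *)
Lemma dlnn_kernelE U :
  dlnn_kernel X Y rho U =
    profile N N./2.+1 (c1 X) coefH2 coefH3 coefH4 (radius U).
Proof.
have NE := odd_double_half N.
have N0 : N%:R != 0 :> R by rewrite pnatr_eq0 -lt0n ltnW.
have H1E : H1 U = radius U ^+ (2 * N) by rewrite exprM radius_sqr.
have H4E : H4 U = radius U ^+ 2 by rewrite radius_sqr.
have H2E : ~~ odd N -> H2 U = radius U ^+ N.
  move=> /negbTE evN; rewrite /H2 -radius_sqr; rewrite evN add0n in NE.
  have -> : N%:R / 2 = (N./2)%:R :> R.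
    by rewrite -{1}NE -mul2n natrM mulrC mulKf.
  by rewrite powR_mulrn ?sqr_ge0 // -exprM mul2n NE.
have H3E : odd N -> H3 U = quad N (radius U) ^+ N./2.+1.
  move=> oddN; rewrite oddN in NE; rewrite /H3.
  have -> : (N%:R + 1) / 2 = (N./2.+1)%:R :> R.
    by rewrite natr1 -{1}NE add1n -doubleS -mul2n natrM mulrC mulKf.
  rewrite powR_mulrn ?divr_ge0 ?natr1 ?ler0n ?addr_ge0 ?sqnormF_ge0 //.
  by rewrite /quad radius_sqr mulrCA divff // mulr1 natr1.
rewrite /dlnn_kernel /profile -H1E -H4E /coefH2 /coefH3 /coefH4.
case: (boolP (odd N)) => [oddN|evN].
  have -> : (N == 2%N) = false by apply/eqP => N2; rewrite N2 in oddN.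
  by rewrite /= mul0r addr0 H3E.
rewrite mul0r addr0 -H2E //=.
by case: eqP; rewrite ?mul0r ?addr0.
Qed.

(** For odd N, the exponent m = N./2 + 1 satisfies 2 m = N + 1, so that the
    chain-rule factor 2 m / (N + 1) of [profile_slope] is 1. *)
Lemma root_eqE s r :
  root_eq X Y rho s r <->
  profile_slope N N./2.+1 (c1 X) coefH2 coefH3 coefH4 r
    = s / Num.sqrt N%:R.
Proof.
have NE := odd_double_half N.
rewrite /root_eq /profile_slope /coefH2 /coefH3 /coefH4.
have sub0P (x y : R) : x - y = 0 <-> x = y.
  by split=> [/eqP|->]; rewrite ?subrr // subr_eq0 => /eqP.
case: (boolP (odd N)) => [oddN|evN]; last first.
  rewrite !mul0r addr0; case: eqP => [N2|_] /=; last exact: sub0P.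
  have -> : (2 * N - 1 = 3)%N by rewrite N2.
  have -> : (N - 1 = 1)%N by rewrite N2.
  have -> : N%:R = 2 :> R by rewrite N2.
  by rewrite mulr0 !mul0r addr0 expr1 sub0P.
have -> : (N == 2%N) = false by apply/eqP => N2; rewrite N2 in oddN.
rewrite oddN in NE; rewrite /= mul0r addr0.
have -> : (N%:R - 1) / 2 = (N./2)%:R :> R.
  by rewrite -{1}NE natrD [1 + _]addrC addrK -mul2n natrM mulrC mulKf.
have -> : 2 * (N./2.+1)%:R / (N%:R + 1) = 1 :> R.
  by rewrite -natrM mul2n doubleS -[N in X in _ / X]NE natr1 divff.
by rewrite mulr1 powR_mulrn ?quad_ge0 // sub0P.
Qed.

Let frob_ge0 (m n : nat) (A : 'M[R]_(m, n)) : 0 <= frob A.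
Proof. exact: sqrtr_ge0. Qed.

Let N_ge2R : 2 <= N%:R :> R. Proof. by rewrite ler_nat. Qed.

Lemma c1_ge0 : 0 <= c1 X.
Proof.
rewrite /c1 mulr_ge0 ?sqr_ge0 // divr_ge0 ?mulr_ge0 ?ler0n ?exprn_ge0 //.
by move: N_ge2R; lra.
Qed.

Lemma c1_eq0 : c1 X = 0 -> frob X = 0.
Proof.
have N0 : 0 < N%:R :> R by move: N_ge2R; lra.
have K0 : (2 * N%:R - 1) * N%:R ^+ N / (2 * (N`!)%:R) != 0 :> R.
  rewrite gt_eqF // divr_gt0 ?mulr_gt0 ?exprn_gt0 ?N0 ?ltr0n ?fact_gt0 //.
  by move: N_ge2R; lra.
by move=> /eqP; rewrite mulf_eq0 (negbTE K0) sqrf_eq0 => /eqP.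
Qed.

Lemma c2_ge0 : 0 <= c2 X Y.
Proof.
rewrite /c2 divr_ge0 ?powR_ge0 // !mulr_ge0 ?powR_ge0 //.
by move: N_ge2R; lra.
Qed.

Lemma c3_ge0 : 0 <= c3 X Y.
Proof.
rewrite /c3 divr_ge0 ?powR_ge0 // !mulr_ge0 ?powR_ge0 //.
by move: N_ge2R; lra.
Qed.

(** The zero function violates strong convexity at the midpoint between 0 and
    any nonzero vector. *)
Lemma strongly_convex_neq0 sigma (h : params R N d -> R) :
  (0 < d 0%N)%N -> (0 < d 1%N)%N -> 0 < sigma -> strongly_convex sigma h ->
  exists U, h U != 0.
Proof.
move=> d0 d1 sigma0 sc; apply: contrapT => /forallNP h0.
have {}h0 U : h U = 0 by have /negP/negPn/eqP := h0 U.
pose U : params R N d := @basis_params R N d (Ordinal (ltnW N_ge2))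
  (Ordinal d0) (Ordinal d1).
have U_gt0 : 0 < sqnormF U.
  rewrite lt_def sqnormF_ge0 andbT; apply/eqP => /sqnormF_eq0.
  move=> /(congr1 (fun V : params R N d =>
    V (Ordinal (ltnW N_ge2)) (Ordinal d0) (Ordinal d1))).
  by rewrite !mxE !eqxx => /eqP; rewrite oner_eq0.
have h01 : 0 <= (2^-1 : R) <= 1 by apply/andP; split; lra.
have := sc U 0 2^-1 h01; rewrite !h0 subr0.
have : 0 < sigma * sqnormF U by rewrite mulr_gt0.
lra.
Qed.

(** If the coefficients of H1 and H4 vanish then so does X, since the former is
    a positive multiple of ||X||_F^2; then H2 and H3 have zero coefficients
    as well and the kernel is 0, which is not strongly convex. *)
Lemma kernel_nondegenerate sigma :
    (0 < d 0%N)%N -> (0 < d 1%N)%N -> 0 < sigma -> 0 <= coefH4 ->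
  strongly_convex sigma (dlnn_kernel X Y rho) -> 0 < c1 X + coefH4.
Proof.
move=> d0 d1 sigma0 e0 /(strongly_convex_neq0 d0 d1 sigma0)[U].
rewrite dlnn_kernelE; apply: contraNT; rewrite -leNgt => le0.
have c10 := c1_ge0.
have c1z : c1 X = 0 by lra.
have ez : coefH4 = 0 by lra.
have Xz := c1_eq0 c1z.
have bz : coefH2 = 0 by rewrite /coefH2 /c2 Xz mulr0 !mul0r if_same.
have cz : coefH3 = 0 by rewrite /coefH3 /c3 Xz mulr0 !mul0r if_same.
by rewrite /profile c1z ez bz cz !mul0r !addr0.
Qed.

End Kernel.

(** * The iteration *)

(** The objective of the step, multiplied by lambda, differs from the radial
    proximal objective by a constant independent of U. *)
Lemma bpg_map_minimizes (R : realType) (N : nat) (d : nat -> nat)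
    (mu : 'I_N -> R) (g h : params R N d -> R) (lambda : R)
    (V U U' : params R N d) :
  0 < lambda -> bpg_map (l1_reg mu) g h lambda V U ->
  l1_reg (fun i => lambda * mu i) U
      + inner (lambda *: grad g V - grad h V) U + h U <=
    l1_reg (fun i => lambda * mu i) U'
      + inner (lambda *: grad g V - grad h V) U' + h U'.
Proof.
move=> lambda0 minU.
have l1E Z : l1_reg (fun i => lambda * mu i) Z = lambda * l1_reg mu Z.
  by rewrite /l1_reg mulr_sumr; apply: eq_bigr => i _; rewrite mulrA.
have := minU U'; rewrite -(ler_pM2l lambda0) /bregman !innerBr !mulrDr.
rewrite !mulVKf ?gt_eqF // !l1E !innerBl !innerZl; lra.
Qed.

Theorem proposition23 (R : realType) (N nT : nat) (d : nat -> nat)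
    (X : 'M[R]_(d N, nT)) (Y : 'M[R]_(d 0%N, nT))
    (mu : 'I_N -> R) (rho sigma L lambda : R) (W : nat -> params R N d)
    (hN : (2 <= N)%N) (hd : forall k, (k <= N)%N -> (0 < d k)%N)
    (hnT : (0 < nT)%N)
    (hmu : forall i, 0 < mu i)
    (hrho_even : (2 < N)%N -> ~~ odd N -> 0 < rho)
    (hrho_odd : (2 < N)%N -> odd N -> 0 <= rho) :
  let f : params R N d -> R := l1_reg mu in
  let g : params R N d -> R := loss X Y in
  let h : params R N d -> R := dlnn_kernel X Y rho in
  forall (hsigma : 0 < sigma) (hstrong : strongly_convex sigma h)
    (hL : 0 < L)
    (hLsub : convex (fun U => L * h U - g U))
    (hLadd : convex (fun U => L * h U + g U))
    (hlambda : 0 < lambda < L^-1)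
    (hW : forall k, (1 <= k)%N -> bpg_map f g h lambda (W k) (W k.+1)),
  forall k, (1 <= k)%N ->
  let P : params R N d := lambda *: grad g (W k) - grad h (W k) in
  let S : params R N d := fun i => soft (lambda * mu i) (- P i) in
  let s : R := Num.sqrt (\sum_j frob (S j) ^+ 2) in
  exists r : R,
    [/\ 0 <= r,
        root_eq X Y rho s r,
        forall r', 0 <= r' -> root_eq X Y rho s r' -> r' = r &
        (* if every S i vanishes then s = 0 and the right-hand side is 0,
           since x / 0 = 0 *)
        forall i, W k.+1 i = (r * (Num.sqrt N%:R / s)) *: S i].
Proof.
move=> f g h sigma0 h_sc _ _ _ /andP[lambda0 _] hW k k1 P S s.
have N0 : (0 < N)%N by exact: ltnW.
pose b := coefH2 X Y.
pose c := coefH3 X Y.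
pose e := coefH4 N rho.
have a0 : 0 <= c1 X := c1_ge0 X hN.
have b0 : 0 <= b by rewrite /b /coefH2; case: ifP => // _; exact: c2_ge0.
have c0 : 0 <= c by rewrite /c /coefH3; case: ifP => // _; exact: c3_ge0.
have e0 : 0 <= e.
  rewrite /e /coefH4; case: eqP => [//|/eqP N2].
  have {}N2 : (2 < N)%N by rewrite ltn_neqAle eq_sym N2.
  by case: (boolP (odd N)) => [/(hrho_odd N2)|/(hrho_even N2)/ltW].
have ae : 0 < c1 X + e.
  exact: (kernel_nondegenerate hN (hd 0%N isT) (hd 1%N N0) sigma0 e0 h_sc).
have s0 : 0 <= s by exact: sqrtr_ge0.
have n0 : 0 < Num.sqrt N%:R :> R by rewrite sqrtr_gt0 ltr0n.
pose slope := profile_slope N N./2.+1 (c1 X) b c e.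
have [r r0 slope_r] : exists2 r, 0 <= r & slope r = s / Num.sqrt N%:R.
  by apply: profile_slope_onto => //; rewrite divr_ge0 // ltW.
have slope_inj x y : 0 <= x -> 0 <= y -> slope x = slope y -> x = y.
  by move=> x0 y0; exact: profile_slope_inj.
exists r; split=> //; first exact/root_eqE.
  by move=> r' r'0 /root_eqE slope_r'; apply: slope_inj; rewrite // slope_r.
suff -> : W k.+1 = (r * (Num.sqrt N%:R / s)) *: S by [].
apply: (@prox_radial _ _ _ (fun i => lambda * mu i)
  (profile N N./2.+1 (c1 X) b c e) P) => //.
- by move=> i; rewrite mulr_ge0 // ltW.
- move=> s_eq0; apply: slope_inj => //.
  rewrite slope_r /slope profile_slope0 //.
  by rewrite [s]s_eq0 mul0r.
- move=> t t0 tr.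
  apply: le_lt_trans (profile_above_tangent _ _ a0 b0 c0 e0 ae t0 r0 tr) => //.
  rewrite -/slope slope_r.
  suff -> : N%:R * (s / Num.sqrt N%:R) = s * Num.sqrt N%:R by [].
  by rewrite -{1}[N%:R]sqr_sqrtr ?ler0n // expr2 mulrCA mulfK ?gt_eqF.
- move=> U'; rewrite -!dlnn_kernelE //.
  exact: bpg_map_minimizes (hW k k1).
Qed.
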